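(* For every integer $k\geq 3$, $$\operatorname{gr}_k(P_5:S_5^1)= \begin{cases} 21, & k=3;\\ 6, & k=4,5;\\ 5, & k=6;\\ \left\lceil\frac{1+\sqrt{1+8k}}{2}\right\rceil, & k\geq 7. \end{cases}$$
   Context: All graphs are finite, simple and undirected. $K_n$ is the complete graph on $n$ vertices and $P_5$ is the path with $5$ vertices and $4$ edges. $S_t^r$ is the graph of order $t$ obtained from the star $K_{1,t-1}$ by adding $r$ pairwise independent edges between the leaves; thus $S_5^1$ is the star $K_{1,4}$ with one edge added between two leaves. A $k$-edge-coloring assigns to each edge one of $k$ colors; all $k$-edge-colorings are assumed exact, i.e. each of the $k$ colors is used at least once. An edge-colored graph is rainbow if all its edges have different colors and monochromatic if all its edges have a single color. A copy of a graph means a (not necessarily induced) subgraph isomorphic to it. For non-empty graphs $G,H$ (graphs with at least one edge) and a positive integer $k$, the Gallai-Ramsey number $\operatorname{gr}_k(G:H)$ is the minimum integer $N$ with $\binom{N}{2}\geq k$ (so that $K_N$ admits a $k$-edge-coloring) such that for all $n\geq N$, every $k$-edge-coloring of $K_n$ contains either a rainbow copy of $G$ or a monochromatic copy of $H$. *)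

(* Defs.v *)
From mathcomp Require Import all_boot.

Set Implicit Arguments.
Unset Strict Implicit.
Unset Printing Implicit Defensive.

Record sgraph := SGraph {
  vertex :> finType;
  adj : rel vertex;
  adj_sym : symmetric adj;
  adj_irr : irreflexive adj }.

Definition edges (G : sgraph) : {set {set G}} :=
  [set [set p.1; p.2] | p in [set p : G * G | adj p.1 p.2]].

Section OfRel.
Variables (T : finType) (r : rel T).

Definition simple_closure : rel T := [rel x y | (x != y) && (r x y || r y x)].

Lemma simple_closure_sym : symmetric simple_closure.
Proof. by move=> x y; rewrite /simple_closure /= eq_sym orbC. Qed.

Lemma simple_closure_irr : irreflexive simple_closure.
Proof. by move=> x; rewrite /simple_closure /= eqxx. Qed.

Definition sgraph_of_rel : sgraph :=
  SGraph simple_closure_sym simple_closure_irr.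
End OfRel.

Definition complete_graph (n : nat) : sgraph :=
  sgraph_of_rel [rel x y : 'I_n | true].

Definition path_graph (n : nat) : sgraph :=
  sgraph_of_rel [rel x y : 'I_n | val y == (val x).+1].

(* The graph S_t^r, meaningful when 2 r <= t - 1: the centre of the star is 0,
   its leaves are 1, ..., t - 1, and the r independent edges added between
   leaves are {1, 2}, {3, 4}, ..., {2 r - 1, 2 r}. *)
Definition star_plus (t r : nat) : sgraph :=
  sgraph_of_rel [rel x y : 'I_t | (val x == 0) ||
    [exists i : 'I_r, (val x == (2 * i).+1) && (val y == (2 * i).+2)]].

(* Only the values on [edges G] are ever used; the others are junk. *)
Definition edge_coloring (G : sgraph) (k : nat) := {set G} -> 'I_k.

Definition exact_coloring (G : sgraph) (k : nat) (c : edge_coloring G k) :=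
  forall j : 'I_k, exists2 e, e \in edges G & c e = j.

(* [f] exhibits a (not necessarily induced) subgraph of [G] isomorphic to [F]. *)
Definition is_copy (F G : sgraph) (f : F -> G) :=
  injective f /\ forall x y : F, adj x y -> adj (f x) (f y).

Definition has_rainbow_copy (F G : sgraph) (k : nat) (c : edge_coloring G k) :=
  exists2 f : F -> G, is_copy f &
    {in edges F &, injective (fun e : {set F} => c (f @: e))}.

Definition has_monochromatic_copy
    (F G : sgraph) (k : nat) (c : edge_coloring G k) :=
  exists2 f : F -> G, is_copy f &
    exists j : 'I_k, forall e : {set F}, e \in edges F -> c (f @: e) = j.

Definition gallai_ramsey_bound (k : nat) (G H : sgraph) (N : nat) :=
  k <= 'C(N, 2) /\
  forall n : nat, N <= n ->
  forall c : edge_coloring (complete_graph n) k, exact_coloring c ->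
    has_rainbow_copy G c \/ has_monochromatic_copy H c.

(* [N] is gr_k(G : H). *)
Definition is_gallai_ramsey_number (k : nat) (G H : sgraph) (N : nat) :=
  gallai_ramsey_bound k G H N /\
  forall M : nat, gallai_ramsey_bound k G H M -> N <= M.

(* Main.v *)
Require Import Defs.
From mathcomp Require Import all_boot all_order all_algebra.
From mathcomp Require Import reals zify ring.
Import Order.TTheory GRing.Theory Num.Theory.

(* Call S_5^1 a cricket.  Three colors cannot make P_5 rainbow, so k = 3 is a Ramsey problem on
   K_21.  If a vertex has 9 neighbours in one color i, these either span an edge of color i, which
   gives a cricket, or form a 2-colored K_9, where the same argument applies again.  Otherwise
   every color degree is at least 20 - 2 * 8 = 4, so a monochromatic triangle, which exists as
   21 >= 17 >= R(3, 3, 3), extends to a cricket.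

   For k >= 4 and n >= 6, take four edges of distinct colors.  Exchanging one of them for an edge
   joining two others leads to four colors on at most 5 vertices, or to a rainbow K_2 + P_4 or
   2 P_3 on 6 vertices.  These cases, and K_5 with at least 6 colors, are settled by an exhaustive
   search over colorings up to renaming of the colors, pruned when a forbidden copy appears. *)

(** * Forbidden copies as vertex lists *)

(* With b = true the edges of P_5, with b = false those of the cricket centred at x0. *)
Definition copy_pairs {A : Type} (b : bool) (v : seq A) : seq (A * A) :=
  if v is [:: x0; x1; x2; x3; x4] then
    if b then [:: (x0, x1); (x1, x2); (x2, x3); (x3, x4)]
    else [:: (x0, x1); (x0, x2); (x0, x3); (x0, x4); (x1, x2)]
  else [::].

Definition pair_colors {A C : Type} (d : A -> A -> C) (l : seq (A * A)) :=
  [seq d p.1 p.2 | p <- l].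

(** The boolean selects the condition, so that one list of patterns and one search treat rainbow
    paths and monochromatic crickets together. *)
Definition forbidden {C : eqType} (b : bool) (l : seq C) :=
  if b then uniq l else constant l.

Definition has_pattern {T C : eqType} (b : bool) (d : T -> T -> C) :=
  exists v, [/\ size v = 5, uniq v & forbidden b (pair_colors d (copy_pairs b v))].

Definition has_forbidden {T C : eqType} (d : T -> T -> C) := exists b, has_pattern b d.

(** * Exhaustive search over colorings *)

Fixpoint arrangements (m : nat) (s : seq nat) : seq (seq nat) :=
  if m is m'.+1 then
    flatten [seq [seq x :: w | w <- arrangements m' (rem x s)] | x <- s]
  else [:: [::]].

Lemma arrangementsP m s w : uniq s -> w \in arrangements m s ->
  [/\ size w = m, uniq w & {subset w <= s}].
Proof.
elim: m s w => [|m IH] s w us /=.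
  by rewrite inE => /eqP->.
move=> /flattenP[l /mapP[x xs ->]] /mapP[w' /IH []].
  exact: rem_uniq.
move=> sw uw sub ->; split=> /=.
- by rewrite sw.
- by rewrite uw andbT; apply/negP=> /sub; rewrite mem_rem_uniq // !inE eqxx.
- by move=> y; rewrite inE => /orP[/eqP->|/sub /mem_rem].
Qed.

Lemma mem_arrangements m s w : uniq s -> size w = m -> uniq w -> {subset w <= s} ->
  w \in arrangements m s.
Proof.
elim: m s w => [|m IH] s [|x w] //= us [sw] /andP[xw uw] sub.
apply/flattenP; exists [seq x :: w' | w' <- arrangements m (rem x s)].
  by apply: (map_f (fun x => [seq x :: w' | w' <- arrangements m (rem x s)])); rewrite sub ?mem_head.
apply: map_f; apply: IH; rewrite ?rem_uniq // => y yw.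
by rewrite mem_rem_uniq // !inE sub ?inE ?yw ?orbT // andbT; apply: contraNneq xw => <-.
Qed.

(* The index of the edge {p.1, p.2} in a list of edges (i, j), i < j. *)
Definition position (order : seq (nat * nat)) (p : nat * nat) :=
  index (minn p.1 p.2, maxn p.1 p.2) order.

(** The inequalities keep one vertex list per copy: a path has two, by reversal, and a cricket four,
    by exchanging x1 with x2 and x3 with x4. *)
Definition patterns (n : nat) (order : seq (nat * nat)) : seq (bool * seq nat) :=
  let A := arrangements 5 (iota 0 n) in
  [seq (true, [seq position order p | p <- copy_pairs true v])
    | v <- A & nth 0 v 0 < nth 0 v 4] ++
  [seq (false, [seq position order p | p <- copy_pairs false v])
    | v <- A & (nth 0 v 1 < nth 0 v 2) && (nth 0 v 3 < nth 0 v 4)].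

Definition groups (n : nat) (order : seq (nat * nat)) :=
  let P := patterns n order in
  [seq [seq q <- P | foldr maxn 0 q.2 == i] | i <- iota 0 (size order)].

(* The colors p of the first edges extend by either an old color or the fresh color [size p];
   the head of gs lists the forbidden copies whose last edge is the next one. *)
Fixpoint search (fin : seq nat -> bool) (gs : seq (seq (bool * seq nat)))
    (p : seq nat) : bool :=
  if gs is g :: gs' then
    all (fun x => let p' := rcons p x in
           if has (fun q => forbidden q.1 [seq nth 0 p' i | i <- q.2]) g
           then true else search fin gs' p')
        (size p :: undup p)
  else fin p.

(* K_5 comes first. *)
Definition K6_order :=
  [:: (0,1);(0,2);(1,2);(0,3);(1,3);(2,3);(0,4);(1,4);(2,4);(3,4);
      (0,5);(1,5);(2,5);(3,5);(4,5)].
(* The next two lists start with the edges of K_2 + P_4 and of 2 P_3. *)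
Definition K2P4_order :=
  [:: (0,1);(2,3);(3,4);(4,5);(0,2);(1,2);(0,3);(1,3);(0,4);(1,4);(2,4);
      (0,5);(1,5);(2,5);(3,5)].
Definition P3P3_order :=
  [:: (0,1);(1,2);(3,4);(4,5);(0,2);(0,3);(1,3);(2,3);(0,4);(1,4);(2,4);
      (0,5);(1,5);(2,5);(3,5)].

(** The test at the leaves of the K_5 search. Colorings with at least six colors must not survive,
    and those with four or five must not extend to K_6. The conditionals, unlike [||], keep
    [vm_compute] from running the inner search where it is already decided. *)
Definition K5_final (p : seq nat) : bool :=
  if size (undup p) < 4 then true else if 5 < size (undup p) then false else
  search (fun=> false) (drop 10 (groups 6 K6_order)) p.

Lemma K5_search : search K5_final (take 10 (groups 5 K6_order)) [::].
Proof. by vm_compute. Qed.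

Lemma K2P4_search : search (fun=> false) (drop 4 (groups 6 K2P4_order)) [:: 0; 1; 2; 3].
Proof. by vm_compute. Qed.

Lemma P3P3_search : search (fun=> false) (drop 4 (groups 6 P3P3_order)) [:: 0; 1; 2; 3].
Proof. by vm_compute. Qed.

(** * Soundness of the search *)

(* Each color is renamed to the position of its first occurrence. *)
Definition canon {C : eqType} (s : seq C) := [seq index x s | x <- s].

Definition restricted_growth (t : seq nat) :=
  forall i, i < size t -> (nth 0 t i == i) || (nth 0 t i \in take i t).

(** A color seen for the first time is named by its own position, as is the fresh color [size p] in
    [search]; any other color repeats an earlier name. So [search] tries every continuation of a
    canonical word. *)
Lemma canon_growth (C : eqType) (s : seq C) : restricted_growth (canon s).
Proof.
move=> i; rewrite size_map => si.
case: s si => // c s0; set s := c :: s0 => si; set x := nth c s i.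
rewrite (nth_map c) // -/x -map_take.
have [xt|] := boolP (x \in take i s); first by apply/orP; right; apply: (map_f (index^~ s)).
rewrite (in_take_leq _ (ltnW si)) -leqNgt => ge; apply/orP; left.
have : x \in take i.+1 s by rewrite (take_nth c) // mem_rcons mem_head.
by move/index_ltn; rewrite ltnS eqn_leq ge andbT.
Qed.

Lemma index_inj_in (C : eqType) (s : seq C) : {in s &, injective (index^~ s)}.
Proof. by move=> x y xs ys e; rewrite -(nth_index x xs) -[RHS](nth_index x ys) e. Qed.

Lemma constant_map_in (A B : eqType) (f : A -> B) (l : seq A) :
  {in l &, injective f} -> constant (map f l) = constant l.
Proof.
case: l => //= x l inj; rewrite all_map; apply: eq_in_all => y yl /=.
by apply/eqP/eqP=> [/inj->|->] //; rewrite !inE ?eqxx ?yl ?orbT.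
Qed.

Lemma forbidden_map_in (A B : eqType) (f : A -> B) b (l : seq A) :
  {in l &, injective f} -> forbidden b (map f l) = forbidden b l.
Proof. by case: b => inj; [apply: map_inj_in_uniq | apply: constant_map_in]. Qed.

(** Restricted growth ensures that the branch spelled by [r] is explored. The bound on the entries
    of [q] makes each test on a prefix agree with the test on the whole word. *)
Lemma searchP (fin : seq nat -> bool) (gs : seq (seq (bool * seq nat))) p r :
    restricted_growth (p ++ r) -> size r = size gs ->
    (forall i q, q \in nth [::] gs i -> {in q.2, forall e, e <= size p + i}) ->
    search fin gs p ->
  (exists2 q, q \in flatten gs & forbidden q.1 [seq nth 0 (p ++ r) i | i <- q.2])
  \/ fin (p ++ r).
Proof.
elim: gs p r => [|g gs IH] p [|x r] //=; first by rewrite cats0; right.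
move=> rg [sr] wf /andP[h1 h2].
have {h1 h2} : if has (fun q => forbidden q.1 [seq nth 0 (rcons p x) i | i <- q.2]) g
           then true else search fin gs (rcons p x).
  have := rg (size p); rewrite size_cat /= -[X in X < _]addn0 ltn_add2l => /(_ isT).
  rewrite nth_cat ltnn subnn take_size_cat //= => /orP[/eqP->//|xp].
  by move: h2 => /allP; apply; rewrite mem_undup.
case: ifP => [/hasP[q qg fq] _|_ hs].
  left; exists q; first by rewrite /= mem_cat qg.
  move: fq; congr (forbidden _ _); apply/eq_in_map=> e /(wf 0 q qg).
  by rewrite addn0 -cat_rcons nth_cat size_rcons ltnS => ->.
rewrite -cat_rcons; case: (IH (rcons p x) r) => //.
- by rewrite cat_rcons.
- move=> i q qi e /(wf i.+1 q qi); by rewrite size_rcons addnS.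
- by case=> q qf fq; left; exists q => //; rewrite mem_cat qf orbT.
- by right.
Qed.

Lemma patternsP n order (q : bool * seq nat) : q \in patterns n order ->
  exists v, [/\ size v = 5, uniq v, {subset v <= iota 0 n} &
    q.2 = [seq position order p | p <- copy_pairs q.1 v]].
Proof.
rewrite mem_cat => /orP[] /mapP[v]; rewrite mem_filter => /andP[_ /arrangementsP];
by case=> // [|sv uv sub ->]; [exact: iota_uniq | exists v].
Qed.

Lemma mem_groups n order i (q : bool * seq nat) : q \in nth [::] (groups n order) i ->
  q \in patterns n order /\ {in q.2, forall e, e <= i}.
Proof.
have [lt|ge] := ltnP i (size order); last by rewrite nth_default ?size_map ?size_iota.
rewrite (nth_map 0) ?size_iota // nth_iota // add0n mem_filter => /andP[/eqP <- ->]; split=> //.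
elim: q.2 => //= e l IH x; rewrite inE leq_max => /orP[/eqP->|/IH->]; by rewrite ?leqnn ?orbT.
Qed.

Lemma copy_pairs_map (A B : Type) (f : A -> B) b v :
  copy_pairs b (map f v) = [seq (f p.1, f p.2) | p <- copy_pairs b v].
Proof. by case: v => [|? [|? [|? [|? [|? []]]]]] //; case: b. Qed.

Lemma copy_pairsP (T : eqType) b (v : seq T) p : uniq v -> p \in copy_pairs b v ->
  [/\ p.1 \in v, p.2 \in v & p.1 != p.2].
Proof.
case: v => [|x0 [|x1 [|x2 [|x3 [|x4 []]]]]] //.
by case: b => /=; rewrite !inE !negb_or => /andP[/and4P[? ? ? ?]]
  /andP[/and3P[? ? ?]] /andP[/andP[? ?]] /andP[? _];
  do 4?[case/orP]; move=> /eqP->; split; rewrite //= ?inE ?eqxx ?orbT.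
Qed.

Definition complete_order n (order : seq (nat * nat)) :=
  all (fun j => all (fun i => (i < j) ==> ((i, j) \in order)) (iota 0 n)) (iota 0 n).

Lemma position_mem n order i j : complete_order n order ->
  i < n -> j < n -> i != j -> (minn i j, maxn i j) \in order.
Proof.
move=> /allP co; wlog: i j / i < j.
  move=> wl ni nj ne; have := ne; rewrite neq_ltn => /orP[lt|lt].
    by apply: wl.
  by rewrite minnC maxnC; apply: wl => //; rewrite eq_sym.
move=> lt ni nj _; rewrite (minn_idPl (ltnW lt)) (maxn_idPr (ltnW lt)).
by have /co/allP/(_ i) : j \in iota 0 n; rewrite mem_iota //= ni lt /= => ->.
Qed.

Lemma size_groups n order : size (groups n order) = size order.
Proof. by rewrite /groups size_map size_iota. Qed.

Section Coloring.
Variables (T C : eqType) (d : T -> T -> C) (x0 : T).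
Hypothesis dC : forall x y, d x y = d y x.

Definition order_colors (u : seq T) (order : seq (nat * nat)) :=
  pair_colors (fun i j => d (nth x0 u i) (nth x0 u j)) order.

(** Vertex i of the pattern becomes entry i of [u]. Renaming is injective on the colors that occur,
    so it neither creates nor destroys a forbidden copy. *)
Lemma pattern_forbidden n order u q : uniq u -> n <= size u ->
    complete_order n order -> q \in patterns n order ->
    forbidden q.1 [seq nth 0 (canon (order_colors u order)) i | i <- q.2] ->
  has_forbidden d.
Proof.
move=> uu nu co /patternsP[v [sv uv sub ->]] fb.
(* A default color for [nth]. *)
have c0 := d x0 x0.
pose s := order_colors u order.
exists q.1, [seq nth x0 u i | i <- v]; split; first by rewrite size_map.
  rewrite map_inj_in_uniq // => i j /sub + /sub; rewrite !mem_iota /= => ni nj /eqP.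
  by rewrite nth_uniq ?(leq_trans _ nu) // => /eqP.
have pos p : p \in copy_pairs q.1 v -> position order p < size order /\
    nth c0 s (position order p) = d (nth x0 u p.1) (nth x0 u p.2).
  move=> /(copy_pairsP _ _ _ _ uv) [/sub + /sub]; rewrite !mem_iota /= => n1 n2 ne.
  have po := position_mem _ _ _ _ co n1 n2 ne.
  split; first by rewrite index_mem.
  rewrite (nth_map (0, 0)) ?index_mem // nth_index //=.
  by case: ltngtP => [_|_|->].
move: fb; rewrite -map_comp copy_pairs_map.
have -> : [seq ((nth 0 (canon s)) \o position order) i | i <- copy_pairs q.1 v] =
    [seq index x s | x <- pair_colors d [seq (nth x0 u p.1, nth x0 u p.2) | p <- copy_pairs q.1 v]].
  rewrite /pair_colors -!map_comp; apply/eq_in_map => p /pos[lt e] /=.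
  by rewrite (nth_map c0) ?size_map // e.
rewrite forbidden_map_in // => a b ha hb; apply: index_inj_in.
  move: ha; rewrite /pair_colors -map_comp => /mapP[p /pos[lt e] -> /=].
  by rewrite -e mem_nth // size_map.
move: hb; rewrite /pair_colors -map_comp => /mapP[p /pos[lt e] -> /=].
by rewrite -e mem_nth // size_map.
Qed.

(** The first [a] edges are colored beforehand and the next [b] are searched. This covers the run on
    K_5, its continuation to K_6, and the runs from four prescribed edges. *)
Lemma search_groups fin a b n order u : uniq u -> n <= size u ->
    complete_order n order -> a + b <= size order ->
    search fin (take b (drop a (groups n order)))
      (take a (canon (order_colors u order))) ->
  has_forbidden d \/ fin (take (a + b) (canon (order_colors u order))).
Proof.
move=> uu nu co ab; set t := canon _.
have st : size t = size order by rewrite !size_map.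
have sg := size_groups n order.
have ta : size (take a t) = a by rewrite size_takel // st (leq_trans _ ab) ?leq_addr.
rewrite takeD => sr; have [|||[q qg fq]|] := searchP _ _ _ (take b (drop a t)) _ _ _ sr; last by right.
- move=> i; rewrite -takeD size_takel ?st // => lt.
  rewrite nth_take // take_takel ?(ltnW lt) //.
  by apply: canon_growth; rewrite -/t st (leq_trans lt).
- by rewrite !size_takel // size_drop ?st ?sg leq_subRL ?(leq_trans _ ab) ?leq_addr.
- move=> i q; rewrite ta; have [lt|ge] := ltnP i b.
    by rewrite nth_take // nth_drop => /mem_groups[].
  by rewrite nth_default // (leq_trans _ ge) // size_take_min geq_minl.
left; have qP : q \in patterns n order /\ {in q.2, forall e, e < a + b}.
  have /flattenP[g gin qin] := qg.
  have /(nthP [::])[i] := gin; rewrite size_takel ?size_drop ?sg ?leq_subRL ?(leq_trans _ ab) ?leq_addr //.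
  move=> lt gi; move: qin; rewrite -gi nth_take // nth_drop => /mem_groups[-> le].
  by split=> // e /le le'; rewrite (leq_ltn_trans le') // ltn_add2l.
case: qP => qP qs.
apply: (pattern_forbidden n order u q) => //.
move: fq; rewrite -takeD; congr (forbidden _ _); apply/eq_in_map => e /qs lt.
by rewrite nth_take.
Qed.

Lemma search_take_groups fin b n order u : uniq u -> n <= size u ->
    complete_order n order -> b <= size order ->
    search fin (take b (groups n order)) [::] ->
  has_forbidden d \/ fin (take b (canon (order_colors u order))).
Proof.
move=> uu nu co le hs; have := search_groups fin 0 b n order u uu nu co.
by rewrite drop0 take0; apply.
Qed.

Lemma search_drop_groups fin a n order u : uniq u -> n <= size u ->
    complete_order n order -> a <= size order ->
    search fin (drop a (groups n order)) (take a (canon (order_colors u order))) ->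
  has_forbidden d \/ fin (canon (order_colors u order)).
Proof.
move=> uu nu co le hs.
have := search_groups fin a (size order - a) n order u uu nu co.
rewrite subnKC // [take (_ - _) _]take_oversize ?size_drop ?size_groups //.
rewrite [take (size order) _]take_oversize ?size_map //.
by apply.
Qed.
End Coloring.

(** * Four colors on six vertices *)

Lemma size_undup_map_index (C : eqType) (l s : seq C) : {subset l <= s} ->
  size (undup l) <= size (undup [seq index x s | x <- l]).
Proof.
move=> sub; rewrite -(size_map (index^~ s)); apply: uniq_leq_size.
  rewrite map_inj_in_uniq ?undup_uniq // => x y.
  by rewrite !mem_undup => /sub xs /sub ys; apply: index_inj_in.
by move=> i /mapP[x]; rewrite !mem_undup => xl ->; apply: (map_f (index^~ s)).
Qed.

Lemma extend_uniq (T : finType) (s : seq T) m : uniq s -> size s <= m <= #|T| ->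
  exists r, uniq (s ++ r) /\ size (s ++ r) = m.
Proof.
move=> us /andP[sm mT]; pose r := [seq x <- enum T | x \notin s].
have ur : uniq (s ++ r).
  rewrite cat_uniq us filter_uniq ?enum_uniq // andbT -all_predC.
  by apply/allP => x; rewrite mem_filter => /andP[].
have sr : #|T| <= size (s ++ r).
  rewrite cardE; apply: uniq_leq_size; first exact: enum_uniq.
  by move=> x xT; rewrite mem_cat mem_filter xT andbT orbN.
exists (take (m - size s) r); split; last first.
  rewrite size_cat size_takel ?subnKC // leq_subLR -size_cat.
  exact: leq_trans sr.
by apply: subseq_uniq ur; rewrite cat_subseq // take_subseq.
Qed.

Lemma K5_finalP p : K5_final p -> 4 <= size (undup p) ->
  size (undup p) <= 5 /\ search (fun=> false) (drop 10 (groups 6 K6_order)) p.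
Proof.
rewrite /K5_final; move: (search _ _ _) => b.
by case: ltnP => // _; case: ltnP.
Qed.

Section Unavoidable.
Variables (T : finType) (C : eqType) (d : T -> T -> C).
Hypothesis dC : forall x y, d x y = d y x.

Definition spans m (s : seq T) := exists t : seq C, [/\ uniq t, size t = m &
  forall a, a \in t -> exists x y, [/\ x \in s, y \in s, x != y & d x y = a]].

Lemma spans_edges (es : seq (T * T)) s : uniq (pair_colors d es) ->
  all (fun p => [&& p.1 \in s, p.2 \in s & p.1 != p.2]) es -> spans (size es) s.
Proof.
move=> ue /allP h; exists (pair_colors d es); split=> //; first by rewrite size_map.
by move=> a /mapP[p /h /and3P[h1 h2 h3] ->]; exists p.1, p.2.
Qed.

(** The first ten edges of [K6_order] join its first five vertices, here [u], so they show every
    color used inside [u]. *)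
Lemma spans_order m x0 u r : uniq u -> size u = 5 -> spans m u ->
  m <= size (undup (take 10 (order_colors T C d x0 (u ++ r) K6_order))).
Proof.
move=> uu su [t [ut <- h]]; apply: uniq_leq_size => // a /h[x [y [xu yu ne <-]]].
have co : complete_order 5 (take 10 K6_order) by [].
have ne' : index x u != index y u by apply: contraNneq ne => /index_inj_in-> //.
have := position_mem _ _ _ _ co; rewrite -su => /(_ (index x u) (index y u)).
rewrite !index_mem => /(_ xu yu ne').
rewrite mem_undup -map_take; set f := (fun p => _) => /(map_f f).
suff -> : f (minn (index x u) (index y u), maxn (index x u) (index y u)) = d x y by [].
rewrite /f /=; case: ltngtP ne' => // _ _; rewrite !nth_cat !index_mem xu yu !nth_index //.
Qed.

(** By the K_5 search, a coloring of K_5 with at least four colors and no forbidden copy has at most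
    five colors and does not extend to K_6. Either alternative contradicts this. *)
Lemma five_vertices (x0 : T) u r : uniq (u ++ r) -> size u = 5 -> spans 4 u ->
  r != [::] \/ spans 6 u -> has_forbidden d.
Proof.
move=> ur su s4 alt.
have uu : uniq u by move: ur; rewrite cat_uniq => /andP[].
have s5 : 5 <= size (u ++ r) by rewrite size_cat su leq_addr.
case: (search_take_groups T C d x0 dC K5_final 10 5 K6_order (u ++ r) ur s5 isT isT K5_search); first by [].
set t := take _ _ => ft.
have le m : spans m u -> m <= size (undup t).
  move=> /(spans_order m x0 u r uu su) /leq_trans; apply.
  have -> : t = [seq index a (order_colors T C d x0 (u ++ r) K6_order)
                | a <- take 10 (order_colors T C d x0 (u ++ r) K6_order)].
    by rewrite map_take.
  by apply: size_undup_map_index => a; exact: mem_take.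
have [lt6 hs'] := K5_finalP t ft (le 4 s4).
case: alt => [rn|/le]; last by rewrite leqNgt ltnS lt6.
have s6 : 6 <= size (u ++ r) by rewrite size_cat su; case: (r) rn => // *; rewrite addnS.
by case: (search_drop_groups T C d x0 dC (fun=> false) 10 6 K6_order (u ++ r) ur s6 isT isT hs').
Qed.

(** Adding vertices up to five and then a sixth reduces this to [five_vertices]. *)
Lemma few_vertices s : 6 <= #|T| -> size (undup s) <= 5 -> spans 4 s -> has_forbidden d.
Proof.
move=> T6 s5 [t [ut st h]].
have x0 : T by apply: (enum_val (Ordinal (leq_trans _ T6 : 0 < _))).
have [r [ur sr]] : exists r, uniq (undup s ++ r) /\ size (undup s ++ r) = 5.
  by apply: extend_uniq; rewrite ?undup_uniq // s5 ltnW.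
have e6 : size (undup s ++ r) <= 6 <= #|T| by rewrite sr T6.
have [r' [ur' sr']] := extend_uniq T (undup s ++ r) 6 ur e6.
apply: (five_vertices x0 (undup s ++ r) r' ur' sr).
  exists t; split=> // a /h[x [y [xs ys ne e]]]; exists x, y.
  by rewrite !mem_cat !mem_undup xs ys.
by left; apply: contra_eq_neq sr' => ->; rewrite cats0 sr.
Qed.

Lemma rainbow_prefix (c0 c1 c2 c3 : C) s : uniq [:: c0; c1; c2; c3] ->
  take 4 (canon [:: c0, c1, c2, c3 & s]) = [:: 0; 1; 2; 3].
Proof.
rewrite /canon /= !inE !negb_or => /and4P[/and3P[n1 n2 n3] /andP[n4 n5] n6 _].
by rewrite !eqxx /= (negPf n1) (negPf n2) (negPf n3) (negPf n4) (negPf n5) (negPf n6) take0.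
Qed.

(** If two of the vertices coincide, four colors lie on at most five vertices. Otherwise the edges
    form a rainbow K_2 + P_4, from which the search starts. *)
Lemma K2P4_forbidden x0 x1 x2 x3 x4 x5 : 6 <= #|T| ->
    [&& x0 != x1, x2 != x3, x3 != x4 & x4 != x5] ->
    uniq [:: d x0 x1; d x2 x3; d x3 x4; d x4 x5] ->
  has_forbidden d.
Proof.
move=> T6 ne uc; pose u := [:: x0; x1; x2; x3; x4; x5].
have [uu|nu] := boolP (uniq u); last first.
  apply: (few_vertices u) => //; first by rewrite -ltn_size_undup in nu.
  by apply: (spans_edges [:: (x0, x1); (x2, x3); (x3, x4); (x4, x5)]) => //=;
     rewrite !inE !eqxx ?orbT /= andbT.
have pre : take 4 (canon (order_colors T C d x0 u K2P4_order)) = [:: 0; 1; 2; 3].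
  exact: rainbow_prefix.
have sound := search_drop_groups T C d x0 dC (fun=> false) 4 6 K2P4_order u uu isT isT isT.
by rewrite pre in sound; case: (sound K2P4_search).
Qed.

Lemma P3P3_forbidden x0 x1 x2 x3 x4 x5 : 6 <= #|T| ->
    [&& x0 != x1, x1 != x2, x3 != x4 & x4 != x5] ->
    uniq [:: d x0 x1; d x1 x2; d x3 x4; d x4 x5] ->
  has_forbidden d.
Proof.
move=> T6 ne uc; pose u := [:: x0; x1; x2; x3; x4; x5].
have [uu|nu] := boolP (uniq u); last first.
  apply: (few_vertices u) => //; first by rewrite -ltn_size_undup in nu.
  by apply: (spans_edges [:: (x0, x1); (x1, x2); (x3, x4); (x4, x5)]) => //=;
     rewrite !inE !eqxx ?orbT /= andbT.
have pre : take 4 (canon (order_colors T C d x0 u P3P3_order)) = [:: 0; 1; 2; 3].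
  exact: rainbow_prefix.
have sound := search_drop_groups T C d x0 dC (fun=> false) 4 6 P3P3_order u uu isT isT isT.
by rewrite pre in sound; case: (sound P3P3_search).
Qed.

(** If x3 = x4 the edges form 2 P_3. Otherwise consider the edge x3 x4. If it repeats the color of
    x3 y3 or x4 y4, replacing that edge gives 2 P_3. If not, it closes the path y3 x3 x4 y4, and one
    of x0 x1, x1 x2 of a different color completes K_2 + P_4. *)
Lemma P3_2K2_forbidden x0 x1 x2 x3 y3 x4 y4 : 6 <= #|T| ->
    [&& x0 != x1, x1 != x2, x3 != y3 & x4 != y4] ->
    uniq [:: d x0 x1; d x1 x2; d x3 y3; d x4 y4] ->
  has_forbidden d.
Proof.
move=> T6 /and4P[n0 n1 n3 n4] uc.
have [e|n] := eqVneq x3 x4.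
  apply: (P3P3_forbidden x0 x1 x2 y3 x3 y4) => //.
    by rewrite n0 n1 eq_sym n3 e.
  by rewrite (dC y3) [in d x3 y4]e.
move: (uc) => /=; rewrite !inE !negb_or => /and4P[/and3P[c01 c02 c03] /andP[c12 c13] c23 _].
have [e|f0] := eqVneq (d x3 x4) (d x3 y3).
  apply: (P3P3_forbidden x0 x1 x2 x3 x4 y4); rewrite ?e //.
  by rewrite n0 n1 n n4.
have [e|f1] := eqVneq (d x3 x4) (d x4 y4).
  apply: (P3P3_forbidden x0 x1 x2 y3 x3 x4); rewrite ?e ?(dC y3) //.
  by rewrite n0 n1 eq_sym n3 n.
have [e|f2] := eqVneq (d x3 x4) (d x0 x1).
  apply: (K2P4_forbidden x1 x2 y3 x3 x4 y4); rewrite //.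
    by rewrite n1 eq_sym n3 n n4.
  by rewrite (dC y3) /= !inE !negb_or c12 c13 c23 f1 e eq_sym c01 eq_sym c02.
apply: (K2P4_forbidden x0 x1 y3 x3 x4 y4); rewrite //.
  by rewrite n0 eq_sym n3 n n4.
by rewrite (dC y3) /= !inE !negb_or c02 c03 c23 f1 eq_sym f2 eq_sym f0.
Qed.

(** The same exchange with the edge x0 x1: it gives P_3 + 2 K_2 if it repeats the color of x0 y0 or
    x1 y1, and otherwise joins these two edges into a P_4, while x2 y2 or x3 y3 is dropped. *)
Lemma rainbow_4K2_forbidden x0 y0 x1 y1 x2 y2 x3 y3 : 6 <= #|T| ->
    [&& x0 != y0, x1 != y1, x2 != y2 & x3 != y3] ->
    uniq [:: d x0 y0; d x1 y1; d x2 y2; d x3 y3] ->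
  has_forbidden d.
Proof.
move=> T6 /and4P[n0 n1 n2 n3] uc.
move: (uc) => /=; rewrite !inE !negb_or => /and4P[/and3P[c01 c02 c03] /andP[c12 c13] c23 _].
have [e|n] := eqVneq x0 x1.
  apply: (P3_2K2_forbidden y0 x0 y1 x2 y2 x3 y3) => //.
    by rewrite eq_sym n0 e n1 n2.
  by rewrite (dC y0) [in d x0 y1]e.
have [e|f0] := eqVneq (d x0 x1) (d x0 y0).
  apply: (P3_2K2_forbidden x0 x1 y1 x2 y2 x3 y3); rewrite ?e //.
  by rewrite n n1 n2.
have [e|f1] := eqVneq (d x0 x1) (d x1 y1).
  apply: (P3_2K2_forbidden y0 x0 x1 x2 y2 x3 y3); rewrite ?e ?(dC y0) //.
  by rewrite eq_sym n0 n n2.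
have [e|f2] := eqVneq (d x0 x1) (d x2 y2).
  apply: (K2P4_forbidden x3 y3 y0 x0 x1 y1); rewrite //.
    by rewrite n3 eq_sym n0 n n1.
  by rewrite (dC y0) /= !inE !negb_or f1 c01 ![d x3 y3 == _]eq_sym e c03 c23 c13 c02.
apply: (K2P4_forbidden x2 y2 y0 x0 x1 y1); rewrite //.
  by rewrite n2 eq_sym n0 n n1.
by rewrite (dC y0) /= !inE !negb_or f1 c01 ![d x2 y2 == _]eq_sym c02 f2 c12 eq_sym f0.
Qed.
End Unavoidable.

(** * Multicolor Ramsey bound for the cricket *)

(** The classical recursive upper bound for a monochromatic triangle in m colors: 2, 3, 6, 17 for m
    = 0, 1, 2, 3. *)
Fixpoint triangle_bound m :=
  if m is m'.+1 then (m * (triangle_bound m').-1).+2 else 2.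

(** Its values are 2, 5, 9, 21. The second term forces degree at least 4 in a given color at a
    vertex whose degree in each of the m' other colors is less than [cricket_bound m']. *)
Fixpoint cricket_bound m :=
  if m is m'.+1 then maxn (triangle_bound m) (m' * (cricket_bound m').-1 + 5) else 2.

Section Ramsey.
Variables (T J : finType) (d : T -> T -> J).

Definition colored_by (A : {set T}) (D : {set J}) :=
  {in A &, forall x y, x != y -> d x y \in D}.

Definition nbr (A : {set T}) x i := [set y in A :\ x | d x y == i].

Lemma card_nbr (A : {set T}) D x : x \in A -> colored_by A D ->
  #|A| = (\sum_(i in D) #|nbr A x i|).+1.
Proof.
move=> xA AD; rewrite (cardsD1 x) xA add1n; congr _.+1.
rewrite -sum1_card (partition_big (d x) (mem D)) /=; last first.
  by move=> y /setD1P[yx yA]; apply: AD; rewrite // eq_sym.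
by apply: eq_bigr => i _; rewrite -sum1_card; apply: eq_bigl => y; rewrite !inE.
Qed.

Lemma colored_nbr (A : {set T}) D x i : colored_by A D ->
    (forall y z, y \in nbr A x i -> z \in nbr A x i -> y != z -> d y z != i) ->
  colored_by (nbr A x i) (D :\ i).
Proof.
move=> AD h y z yN zN ne; rewrite !inE h //=.
by move: yN zN; rewrite !inE => /andP[/andP[_ yA] _] /andP[/andP[_ zA] _]; apply: AD.
Qed.

(** By pigeonhole some color i has at least [triangle_bound m] neighbours at x. Either an edge of
    color i joins two of them, or they use one color fewer and induction applies. *)
Lemma mono_triangle m (A : {set T}) (D : {set J}) : #|D| = m ->
    triangle_bound m <= #|A| -> colored_by A D ->
  exists x i y z, [/\ x \in A, y \in nbr A x i, z \in nbr A x i, y != z & d y z = i].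
Proof.
elim: m A D => [|m IH] A D Dm le AD.
  have /card_gt1P[x [y [xA yA ne]]] : 1 < #|A| by [].
  by have := AD x y xA yA ne; rewrite (cards0_eq Dm) inE.
have /card_gt0P[x xA] : 0 < #|A| by apply: leq_trans le.
have [i iD ile] : exists2 i, i \in D & triangle_bound m <= #|nbr A x i|.
  apply/exists_inP; apply: contraLR le => /exists_inPn h.
  rewrite -ltnNge (card_nbr A D x xA AD) /= !ltnS -Dm -sum_nat_const; apply: leq_sum => i iD.
  by have := h i iD; rewrite -ltnNge; case: (triangle_bound m).
have [/exists_inP[y yN /exists_inP[z zN /andP[ne /eqP e]]]|no] :=
    boolP [exists y in nbr A x i, exists z in nbr A x i, (y != z) && (d y z == i)].
  by exists x, i, y, z.
have := IH (nbr A x i) (D :\ i).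
have Dm' : #|D :\ i| = m by move: Dm; rewrite (cardsD1 i) iD => -[].
case/(_ Dm' ile) => [|x' [j [y [z [x'N yN zN ne e]]]]].
  apply: colored_nbr => // y z yN zN ne; apply: contra no => e.
  by apply/exists_inP; exists y => //; apply/exists_inP; exists z; rewrite ?ne.
exists x', j, y, z; split=> //.
- by move: x'N; rewrite !inE => /andP[/andP[]].
- by move: yN; rewrite !inE => /andP[/andP[-> /andP[/andP[_ ->] _]] ->].
- by move: zN; rewrite !inE => /andP[/andP[-> /andP[/andP[_ ->] _]] ->].
Qed.

(** Besides y and z, two more neighbours of x in color i serve as the remaining leaves. *)
Lemma triangle_cricket (A : {set T}) x i y z : 4 <= #|nbr A x i| ->
    y \in nbr A x i -> z \in nbr A x i -> y != z -> d y z = i -> has_pattern false d.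
Proof.
move=> N4 yN zN ne e.
have /card_gt1P[u [v [uN vN uv]]] : 1 < #|nbr A x i :\ y :\ z|.
  have zNy : z \in nbr A x i :\ y by rewrite in_setD1 eq_sym ne zN.
  by move: N4; rewrite (cardsD1 y) yN (cardsD1 z (_ :\ y)) zNy.
exists [:: x; y; z; u; v].
move: yN zN uN vN; rewrite !inE.
move=> /andP[/andP[nyx _] /eqP dy] /andP[/andP[nzx _] /eqP dz].
move=> /and3P[uz uy /andP[/andP[ux _] /eqP du]] /and3P[vz vy /andP[/andP[vx _] /eqP dv]].
split=> //=; last by rewrite dy dz du dv e !eqxx.
by rewrite !inE !negb_or (eq_sym x y) (eq_sym x z) (eq_sym x u)
  (eq_sym x v) (eq_sym y u) (eq_sym y v) (eq_sym z u) (eq_sym z v) nyx nzx ux vx ne uy vy uz vz uv.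
Qed.

Lemma mono_cricket m (A : {set T}) (D : {set J}) : #|D| = m ->
    cricket_bound m <= #|A| -> colored_by A D -> has_pattern false d.
Proof.
elim: m A D => [|m IH] A D Dm le AD.
  have /card_gt1P[x [y [xA yA ne]]] : 1 < #|A| by [].
  by have := AD x y xA yA ne; rewrite (cards0_eq Dm) inE.
move: le; rewrite [cricket_bound _]/= geq_max => /andP[tri deg].
(* A large neighbourhood in color i contains an edge of color i, or has one color fewer and falls
   under the induction hypothesis. *)
have big_nbr x i : x \in A -> i \in D -> 4 <= #|nbr A x i| ->
    cricket_bound m <= #|nbr A x i| -> has_pattern false d.
  move=> xA iD N4 Nm.
  have [/exists_inP[y yN /exists_inP[z zN /andP[ne /eqP e]]]|no] :=
      boolP [exists y in nbr A x i, exists z in nbr A x i, (y != z) && (d y z == i)].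
    exact: triangle_cricket N4 yN zN ne e.
  apply: (IH (nbr A x i) (D :\ i)) => //.
    by move: Dm; rewrite (cardsD1 i) iD => -[].
  apply: colored_nbr => // y z yN zN ne; apply: contra no => e.
  by apply/exists_inP; exists y => //; apply/exists_inP; exists z; rewrite ?ne.
have [/exists_inP[x xA /exists_inP[i iD /andP[]]]|no] :=
    boolP [exists x in A, exists i in D, (4 <= #|nbr A x i|) && (cricket_bound m <= #|nbr A x i|)].
  exact: big_nbr.
have [x [i [y [z [xA yN zN ne e]]]]] := mono_triangle _ A D Dm tri AD.
have iD : i \in D.
  move: yN; rewrite !inE => /andP[/andP[yx yA] /eqP<-].
  by apply: AD; rewrite // eq_sym.
apply: (triangle_cricket A x i y z) => //.
(* Degree at most 3 in color i and less than [cricket_bound m] in each of the m other colors would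
   leave too few vertices. *)
rewrite leqNgt; apply/negP => lt4.
move: deg; rewrite leqNgt => /negP; apply.
rewrite (card_nbr A D x xA AD) (big_setD1 i iD) /= addnC addnS ltnS -addnS leq_add //.
have Dm' : #|D :\ i| = m by move: Dm; rewrite (cardsD1 i) iD => -[].
rewrite -[X in X * _]Dm' -sum_nat_const; apply: leq_sum => j /setD1P[ji jD].
(* A degree reaching [cricket_bound m] is then also at least 4, as [no] requires. The color j shows
   that m is positive; for m = 0 the bound is only 2. *)
have m5 : 4 < cricket_bound m.
  have : 0 < #|D :\ i| by apply/card_gt0P; exists j; rewrite !inE ji.
  by rewrite Dm'; case: (m) => // m' _ /=; rewrite leq_max addnS !addnS ltnS !ltnS leq_addl orbT.
have : (#|nbr A x j| < cricket_bound m).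
  rewrite ltnNge; apply: contra no => le.
  apply/exists_inP; exists x => //; apply/exists_inP; exists j => //.
  by rewrite le (leq_trans _ le) // ltnW.
by case: (cricket_bound m).
Qed.
End Ramsey.

(** * From graph copies to vertex lists *)

(** Spelled out so that membership in [copy_pairs b ord5] reduces by computation. *)
Definition ord5 : seq 'I_5 :=
  [:: @Ordinal 5 0 isT; @Ordinal 5 1 isT; @Ordinal 5 2 isT; @Ordinal 5 3 isT; @Ordinal 5 4 isT].

Lemma map_ord5 (A : Type) x0 (v : seq A) : size v = 5 -> [seq nth x0 v i | i : 'I_5 <- ord5] = v.
Proof. by case: v => [|? [|? [|? [|? [|? []]]]]]. Qed.

Definition edge_color {n k} (c : edge_coloring (complete_graph n) k) (x y : 'I_n) : 'I_k :=
  c [set x; y].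

Lemma edge_colorC n k (c : edge_coloring (complete_graph n) k) x y :
  edge_color c x y = edge_color c y x.
Proof. by rewrite /edge_color setUC. Qed.

Section Copies.
Variables (r : rel 'I_5) (b : bool).
Hypothesis adjE : forall x y, simple_closure r x y =
  ((x, y) \in copy_pairs b ord5) || ((y, x) \in copy_pairs b ord5).

Definition edge_list : seq {set 'I_5} := [seq [set p.1; p.2] | p <- copy_pairs b ord5].

Lemma mem_edge_list : edges (sgraph_of_rel r) =i edge_list.
Proof.
move=> e; apply/imsetP/mapP => [[p]|[p pP ->]].
  rewrite inE /= adjE => /orP[] pP ->; first by exists p => //; case: p pP.
  by exists (p.2, p.1) => //=; rewrite setUC.
by exists p => //; rewrite inE /= adjE; case: p pP => ? ? /= ->.
Qed.

Lemma edge_list_uniq : uniq edge_list.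
Proof.
(* Edges are told apart by their membership vectors along [ord5]. *)
apply: (@map_uniq _ _ (fun e : {set 'I_5} => [seq x \in e | x <- ord5])).
by rewrite /edge_list -map_comp; case: (b); rewrite /= !inE.
Qed.

Variables (n k : nat) (c : edge_coloring (complete_graph n) k).

Lemma copy_colors (f : 'I_5 -> 'I_n) :
  pair_colors (edge_color c) (copy_pairs b (map f ord5)) = [seq c (f @: e) | e : {set 'I_5} <- edge_list].
Proof.
rewrite copy_pairs_map /pair_colors /edge_list -!map_comp; apply: eq_map => p /=.
by rewrite imsetU1 imset_set1.
Qed.

Lemma is_copy_inj (f : 'I_5 -> 'I_n) : injective f ->
  is_copy (F := sgraph_of_rel r) (G := complete_graph n) f.
Proof.
by move=> inj; split=> // x y /andP[ne _]; apply/andP; rewrite (inj_eq inj) ne.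
Qed.

Lemma nth_inj (x0 : 'I_n) (v : seq 'I_n) : size v = 5 -> uniq v ->
  injective (fun i : 'I_5 => nth x0 v i).
Proof.
by move=> sv uv i j /eqP; rewrite nth_uniq ?sv // => /eqP/val_inj.
Qed.

Lemma rainbow_copyP : has_rainbow_copy (sgraph_of_rel r) c <->
  exists v, [/\ size v = 5, uniq v & uniq (pair_colors (edge_color c) (copy_pairs b v))].
Proof.
split=> [[f [inj _] cinj]|[v [sv uv uc]]].
  exists (map f ord5); split; rewrite ?size_map ?(map_inj_uniq inj) // copy_colors.
  rewrite map_inj_in_uniq ?edge_list_uniq // => e e' he he'.
  by apply: cinj; rewrite mem_edge_list.
have x0 : 'I_n by case: v sv {uv uc}.
have inj := nth_inj x0 v sv uv.
exists (fun i : 'I_5 => nth x0 v i); first exact: is_copy_inj.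
move=> e e'; rewrite !mem_edge_list => he he'.
pose g e := c [set nth x0 v (val i) | i : 'I_5 in pred_of_set e].
have {}uc : uniq (map g edge_list) by rewrite -copy_colors map_ord5.
move=> eq.
(* The list of edge colors has no repetition, so equal colors mean equal positions in [edge_list],
   hence equal edges. *)
rewrite -(nth_index set0 he) -(nth_index set0 he'); congr nth; apply/eqP.
rewrite -(nth_uniq (g set0) _ _ uc) ?(size_map g) ?index_mem //.
by rewrite !(nth_map set0) ?index_mem // !nth_index //; apply/eqP.
Qed.

Lemma mono_copyP : has_monochromatic_copy (sgraph_of_rel r) c <->
  exists v, [/\ size v = 5, uniq v & constant (pair_colors (edge_color c) (copy_pairs b v))].
Proof.
split=> [[f [inj _] [j cj]]|[v [sv uv uc]]].
  exists (map f ord5); split; rewrite ?size_map ?(map_inj_uniq inj) // copy_colors.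
  apply: (@all_pred1_constant _ j); apply/allP => _ /mapP[e he ->] /=.
  by apply/eqP/cj; rewrite mem_edge_list.
have x0 : 'I_n by case: v sv {uv uc}.
have inj := nth_inj x0 v sv uv.
exists (fun i : 'I_5 => nth x0 v i); first exact: is_copy_inj.
pose g e := c [set nth x0 v (val i) | i : 'I_5 in pred_of_set e].
have {}uc : constant (map g edge_list) by rewrite -copy_colors map_ord5.
(* The common color is that of the first edge; [g set0] is only a default. *)
exists (head (g set0) (map g edge_list)) => e; rewrite mem_edge_list => /(map_f g) ge.
rewrite -[LHS]/(g e); move: uc ge; case: (map g edge_list) => //= a l /allP h.
by rewrite inE => /orP[/eqP|/h /eqP].
Qed.
End Copies.

Lemma path_adj x y : simple_closure [rel x y : 'I_5 | val y == (val x).+1] x y =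
  ((x, y) \in copy_pairs true ord5) || ((y, x) \in copy_pairs true ord5).
Proof.
by case: x => [[|[|[|[|[|]]]]] ?] //; case: y => [[|[|[|[|[|]]]]] ?].
Qed.

Lemma star_adj x y : simple_closure [rel x y : 'I_5 | (val x == 0) ||
    [exists i : 'I_1, (val x == (2 * i).+1) && (val y == (2 * i).+2)]] x y =
  ((x, y) \in copy_pairs false ord5) || ((y, x) \in copy_pairs false ord5).
Proof.
have ex (z w : 'I_5) : [exists i : 'I_1, (val z == (2 * i).+1) && (val w == (2 * i).+2)] =
    (val z == 1) && (val w == 2).
  by apply/existsP/idP => [[i]|h]; [rewrite ord1 | exists ord0].
transitivity ((x != y) && ((val x == 0) || (val x == 1) && (val y == 2) ||
    ((val y == 0) || (val y == 1) && (val x == 2)))); first by rewrite -!ex.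
by case: x => [[|[|[|[|[|]]]]] ?] //; case: y => [[|[|[|[|[|]]]]] ?].
Qed.

Lemma rainbow_pathP n k (c : edge_coloring (complete_graph n) k) :
  has_rainbow_copy (path_graph 5) c <-> has_pattern true (edge_color c).
Proof. exact: rainbow_copyP path_adj _ _ c. Qed.

Lemma mono_cricketP n k (c : edge_coloring (complete_graph n) k) :
  has_monochromatic_copy (star_plus 5 1) c <-> has_pattern false (edge_color c).
Proof. exact: mono_copyP star_adj _ _ c. Qed.

Lemma has_forbiddenP n k (c : edge_coloring (complete_graph n) k) :
  has_rainbow_copy (path_graph 5) c \/ has_monochromatic_copy (star_plus 5 1) c
  <-> has_forbidden (edge_color c).
Proof.
rewrite rainbow_pathP mono_cricketP; split=> [[h|h]|[[] h]].
- by exists true.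
- by exists false.
- by left.
- by right.
Qed.

(** * Upper bounds *)

Lemma exact_edge n k (c : edge_coloring (complete_graph n) k) j : exact_coloring c ->
  exists x y, x != y /\ edge_color c x y = j.
Proof.
move=> /(_ j)[_ /imsetP[p + ->] e]; rewrite inE => /andP[ne _].
by exists p.1, p.2.
Qed.

Lemma spans_exact n k (c : edge_coloring (complete_graph n) k) m : exact_coloring c ->
  m <= k -> spans 'I_n 'I_k (edge_color c) m (enum 'I_n).
Proof.
move=> ex mk; exists (take m (enum 'I_k)); split.
- by rewrite take_uniq // enum_uniq.
- by rewrite size_takel // size_enum_ord.
- move=> j _; have [x [y [ne e]]] := exact_edge n k c j ex.
  by exists x, y; rewrite !mem_enum.
Qed.

(** For n >= 6, exactness gives four edges of distinct colors. For n = 5 the last hypothesis forces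
    k >= 6, and K_5 itself shows six colors. *)
Lemma gallai_bound_4 k N : k <= 'C(N, 2) -> 4 <= k -> 5 <= N ->
    (6 <= k) || (6 <= N) ->
  gallai_ramsey_bound k (path_graph 5) (star_plus 5 1) N.
Proof.
move=> kN k4 N5 alt; split=> // n Nn c ex; apply/has_forbiddenP.
have dC := edge_colorC n k c.
have [n6|n5] := leqP 6 n.
  have ed i : i < 4 -> exists x y, x != y /\ edge_color c x y = i :> nat.
    move=> lt; have [x [y [ne e]]] := exact_edge n k c (Ordinal (leq_trans lt k4)) ex.
    by exists x, y; rewrite e.
  have [x0 [y0 [n0 e0]]] := ed 0 isT; have [x1 [y1 [n1 e1]]] := ed 1 isT.
  have [x2 [y2 [n2 e2]]] := ed 2 isT; have [x3 [y3 [n3 e3]]] := ed 3 isT.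
  apply: (rainbow_4K2_forbidden _ _ _ dC x0 y0 x1 y1 x2 y2 x3 y3).
  - by rewrite card_ord.
  - by rewrite n0 n1 n2 n3.
  - by rewrite -(map_inj_uniq val_inj) /= e0 e1 e2 e3.
have {}n5 : n = 5 by apply/eqP; rewrite eqn_leq -ltnS n5 (leq_trans N5).
have k6 : 6 <= k by move: alt; rewrite [6 <= N]leqNgt (leq_ltn_trans Nn) ?n5 // orbF.
subst n; apply: (five_vertices _ _ _ dC ord0 (enum 'I_5) [::]).
- by rewrite cats0 enum_uniq.
- by rewrite size_enum_ord.
- exact: spans_exact.
- by right; apply: spans_exact.
Qed.

Lemma gallai_bound_3 : gallai_ramsey_bound 3 (path_graph 5) (star_plus 5 1) 21.
Proof.
split=> // n n21 c _; right; apply/mono_cricketP.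
apply: (mono_cricket _ _ (edge_color c) 3 [set: 'I_n] [set: 'I_3]).
- by rewrite cardsT card_ord.
- by rewrite cardsT card_ord.
- by move=> x y _ _ _; rewrite inE.
Qed.

(** * Lower bounds *)

(** Choosing any ordered pair that represents the edge is harmless since [h] is symmetric. *)
Lemma edge_color_surj n k (h : 'I_n -> 'I_n -> 'I_k.+1) : (forall x y, h x y = h y x) ->
  exists c : edge_coloring (complete_graph n) k.+1, edge_color c =2 h.
Proof.
move=> hC; exists (fun S : {set 'I_n} =>
  if [pick p | S == [set p.1; p.2]] is Some p then h p.1 p.2 else ord0).
move=> x y; rewrite /edge_color; case: pickP => [[a b] /= /eqP/setP e|/(_ (x, y))]; last by rewrite eqxx.
have := e x; have := e y; have := e a; have := e b.
rewrite !inE !eqxx ?orbT /=.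
move=> /orP[]/eqP hb /orP[]/eqP ha /esym/orP[]/eqP hy /esym/orP[]/eqP hx;
by first [congruence | rewrite hC; congruence].
Qed.

(** An exact coloring of K_n without forbidden copies refutes every bound M <= n. It is given on
    natural numbers so that concrete instances can be checked by computation. *)
Lemma gallai_lower n k (g : nat -> nat -> nat) M :
    (forall i j, i < n -> j < n -> g i j = g j i) ->
    (forall i j, g i j < k) ->
    (forall a, a < k -> exists i j, [/\ i < n, j < n, i != j & g i j = a]) ->
    (forall b v, size v = 5 -> uniq v -> all (gtn n) v ->
       ~~ forbidden b (pair_colors g (copy_pairs b v))) ->
    gallai_ramsey_bound k (path_graph 5) (star_plus 5 1) M ->
  n < M.
Proof.
case: k => [|k] gC gk gs gf [_ bd]; first by have := gk 0 0.
rewrite ltnNge; apply/negP => Mn.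
pose h (x y : 'I_n) : 'I_k.+1 := inord (g x y).
have [|c ch] := edge_color_surj n k h; first by move=> x y; rewrite /h gC.
have cg x y : edge_color c x y = g x y :> nat by rewrite ch inordK.
have : has_forbidden (edge_color c).
  apply/has_forbiddenP/bd => // a.
  have [i [j [ni nj ne e]]] := gs a (ltn_ord a).
  exists [set Ordinal ni; Ordinal nj].
    by apply/imsetP; exists (Ordinal ni, Ordinal nj) => //; rewrite inE; apply/andP.
  by apply: val_inj; rewrite -[c _]/(edge_color c _ _) /= cg.
case=> b [v [sv uv]]; apply/negP.
rewrite -(forbidden_map_in _ _ (@nat_of_ord k.+1)); last by move=> x y _ _; apply: val_inj.
have -> : map (@nat_of_ord k.+1) (pair_colors (edge_color c) (copy_pairs b v)) =
    pair_colors g (copy_pairs b (map val v)).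
  by rewrite copy_pairs_map /pair_colors -!map_comp; apply: eq_map => p /=; rewrite cg.
apply: gf; rewrite ?size_map ?(map_inj_uniq val_inj) //.
by apply/allP => _ /mapP[x _ ->] /=.
Qed.

(** Initial segments of [K6_order] list the edges of K_4 and K_5, so a table of 6 or 10 colors
    describes one of these graphs. A pair (i, i) is not in the order and gets the default 0. *)
Definition table_color (s : seq nat) i j := nth 0 s (position K6_order (i, j)).

Definition table_good n k (s : seq nat) :=
  [&& 0 < k, all (gtn k) s,
   all (fun a => has (fun i => has (fun j => (i != j) && (table_color s i j == a))
     (iota 0 n)) (iota 0 n)) (iota 0 k) &
   all (fun v => [&& ~~ forbidden true (pair_colors (table_color s) (copy_pairs true v)) &
     ~~ forbidden false (pair_colors (table_color s) (copy_pairs false v))])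
     (arrangements 5 (iota 0 n))].

Lemma table_lower n k s M : table_good n k s ->
  gallai_ramsey_bound k (path_graph 5) (star_plus 5 1) M -> n < M.
Proof.
case/and4P=> k0 sk ss sf; apply: (gallai_lower n k (table_color s)).
- by move=> i j _ _; rewrite /table_color /position /= minnC maxnC.
- move=> i j; rewrite /table_color; have [lt|ge] := ltnP (position K6_order (i, j)) (size s).
    by move/allP: sk; apply; apply: mem_nth.
  by rewrite nth_default.
- move=> a ak; have /(allP ss)/hasP[i + /hasP[j]] : a \in iota 0 k by rewrite mem_iota.
  by rewrite !mem_iota /= => nj ni /andP[ne /eqP e]; exists i, j.
- move=> b v sv uv /allP nv.
  have /(allP sf)/andP[] : v \in arrangements 5 (iota 0 n).
    apply: mem_arrangements => //; first exact: iota_uniq.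
    by move=> x /nv; rewrite mem_iota.
  by case: b.
Qed.

(* On the blocks {4 q, ..., 4 q + 3} of K_20: color 2 inside a block, and colors 0
   and 1 between blocks following the partition of K_5 into two 5-cycles. *)
Definition block_color a b : nat :=
  if a == b then 2 else (a + 5 - b) %% 5 \in [:: 1; 4].

Lemma block_colorC a b : a < 5 -> b < 5 -> block_color a b = block_color b a.
Proof. by case: a => [|[|[|[|[|]]]]] // _; case: b => [|[|[|[|[|]]]]]. Qed.

(** A 5-cycle has no triangle, so three vertices whose pairs share one color lie in a single
    block. *)
Lemma block_triangle a b e : a < 5 -> b < 5 -> e < 5 ->
  block_color a b = block_color a e -> block_color a b = block_color b e -> a = b.
Proof.
by case: a => [|[|[|[|[|]]]]] // _; case: b => [|[|[|[|[|]]]]] // _;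
   case: e => [|[|[|[|[|]]]]].
Qed.

Lemma block_lower M :
  gallai_ramsey_bound 3 (path_graph 5) (star_plus 5 1) M -> 20 < M.
Proof.
pose g i j := block_color (i %/ 4) (j %/ 4).
have g3 i j : g i j < 3 by rewrite /g /block_color; case: eqP => // _; case: (_ \in _).
apply: (gallai_lower 20 3 g) => //.
- by move=> i j ni nj; apply: block_colorC; rewrite ltn_divLR.
- by case=> [|[|[|]]] // _; [exists 0, 8 | exists 0, 4 | exists 0, 1].
case=> v sv uv nv; apply/negP.
  (* The four edges of P_5 cannot have distinct colors among three. *)
  move=> u4; have : {subset pair_colors g (copy_pairs true v) <= iota 0 3}.
    by move=> _ /mapP[p _ ->]; rewrite mem_iota g3.
  move=> /(uniq_leq_size u4); rewrite size_map.
  by case: v sv {uv nv u4} => [|? [|? [|? [|? [|? []]]]]].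
case: v sv uv nv => [|x0 [|x1 [|x2 [|x3 [|x4 []]]]]] // _ uv.
move=> nv /and5P[/eqP e2 /eqP e3 /eqP e4 /eqP e5 _].
have {}nv x : x \in [:: x0; x1; x2; x3; x4] -> x %/ 4 < 5 by move=> /(allP nv); rewrite ltn_divLR.
(* The triangle x0 x1 x2 lies in one block, so the cricket has color 2 and all five of its vertices
   lie in the block of x0, which has four. *)
have q01 : x0 %/ 4 = x1 %/ 4.
  by apply: (block_triangle _ _ (x2 %/ 4)); rewrite ?nv ?inE ?eqxx ?orbT //; symmetry.
have q x : g x0 x = g x0 x1 -> x %/ 4 = x0 %/ 4.
  rewrite /g /block_color q01 eqxx; case: eqP => [-> //|_].
  by case: (_ \in _).
have : size [:: x0; x1; x2; x3; x4] <= size (iota (4 * (x0 %/ 4)) 4).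
  apply: uniq_leq_size => // x xv; have {xv} e : x %/ 4 = x0 %/ 4.
    by move: xv; rewrite !inE => /or4P[|||/orP[]] /eqP-> //; apply: q.
  by rewrite mem_iota -e mulnC leq_divM /= addnC -mulSn ltn_ceil.
by rewrite size_iota.
Qed.

(** * The closed formula and the main result *)

(** As (2 M - 1)^2 = 1 + 8 C(M, 2), the ceiling is the least M for which K_M has at least k
    edges. *)
Lemma ceil_sqrt_le (R : realType) k M : 0 < k ->
  (absz (Num.ceil ((1 + Num.sqrt (1 + 8 * k%:R : R)) / 2)%R) <= M) = (k <= 'C(M, 2)).
Proof.
move=> k0; set r := (_ / 2)%R.
have r0 : (0 <= r)%R by rewrite divr_ge0 // addr_ge0 // sqrtr_ge0.
have c0 : (0 <= Num.ceil r)%R by rewrite ceil_ge0 (lt_le_trans _ r0) // ltrN10.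
rewrite -lez_nat gez0_abs // ceil_le_int ler_pdivrMr // -lerBrDl.
(* M = 0 is apart because 2 M - 1 is negative there, so squaring is not allowed. *)
case: M => [|M]; first by rewrite bin0n leqNgt k0 mul0r sub0r; apply/negbTE; rewrite -ltNge (lt_le_trans _ (sqrtr_ge0 _)) // ltrN10.
have -> : (M.+1%:~R * 2 - 1 = (2 * M).+1%:R :> R)%R.
  by rewrite -pmulrn -natr1 -[in RHS]natr1 natrM; ring.
rewrite -[X in (_ <= X)%R]ger0_norm // -sqrtr_sqr ler_sqrt ?sqr_ge0 //.
have -> : (1 + 8 * k%:R = (1 + 8 * k)%:R :> R)%R by rewrite natrD natrM.
rewrite -natrX ler_nat.
have e : 'C(M.+1, 2) * 2 = M.+1 * M.
  by rewrite bin2 muln2 even_halfK // oddM /= andNb.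
have -> : (2 * M).+1 ^ 2 = 1 + 8 * 'C(M.+1, 2) by lia.
by rewrite leq_add2l leq_pmul2l.
Qed.

Theorem theorem3p7 (R : realType) (k : nat) (hk : 3 <= k) :
  is_gallai_ramsey_number k (path_graph 5) (star_plus 5 1)
    (match k with
     | 3 => 21
     | 4 | 5 => 6
     | 6 => 5
     | _ => absz (Num.ceil ((1 + Num.sqrt (1 + 8 * k%:R : R)) / 2)%R)
     end).
Proof.
case: k hk => [|[|[|[|[|[|[|k]]]]]]] // _.
- by split; [exact: gallai_bound_3 | exact: block_lower].
- split; first exact: gallai_bound_4.
  (* K_4 in color 0, with the fifth vertex joined to it in the other colors, here and for k = 5. A
     spanning path has at least two edges of color 0, and no color contains a cricket. *)
  by move=> M; apply: (table_lower 5 4 [:: 0; 0; 0; 0; 0; 0; 1; 1; 2; 3]); vm_compute.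
- split; first exact: gallai_bound_4.
  by move=> M; apply: (table_lower 5 5 [:: 0; 0; 0; 0; 0; 0; 1; 2; 3; 4]); vm_compute.
- split; first exact: gallai_bound_4.
  (* A rainbow K_4, too small for a copy on five vertices. *)
  by move=> M; apply: (table_lower 4 6 [:: 0; 1; 2; 3; 4; 5]); vm_compute.
(* For k >= 7 the lower bound is the requirement C(M, 2) >= k alone, and N >= 5 because C(4, 2) =
   6. *)
- set N := absz _; have ceilE M := ceil_sqrt_le R k.+4.+3 M isT.
  have kN : k.+4.+3 <= 'C(N, 2) by rewrite -ceilE.
  split; last by move=> M [kM _]; rewrite ceilE.
  apply: gallai_bound_4 => //.
  rewrite ltnNge; apply: contraL kN => N4.
  by rewrite -ltnNge; apply: leq_ltn_trans (leq_bin2l 2 N4) _.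
Qed.
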